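(* Let $\mathcal{H}_+$ be the set of all quadruples $(a_0,a_1,a_2,a_3)$ of positive integers such that $H(a_0;a_1,a_2,a_3)\subset\mathcal{S}$. For all $i,j\in\{0,1,2,3\}$ with $i<j$, the set $$H_{i,j}:=\left\{\frac{a_i}{a_j} : (a_0,a_1,a_2,a_3)\in\mathcal{H}_+\right\}\subset\mathbb{Q}_+$$ is dense, in the Euclidean topology, in the set $\mathbb{R}_+$ of positive real numbers.
   Context: $\mathcal{S}=\{n^2 : n\in\mathbb{N}\}$ is the set of integer squares. The Hilbert cube of dimension $3$ is $H(a_0;a_1,a_2,a_3)=\{a_0+\varepsilon_1a_1+\varepsilon_2a_2+\varepsilon_3a_3 : \varepsilon_i\in\{0,1\}\}$. No ordering or distinctness of $a_1,a_2,a_3$ is required. *)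

(* Defs.v *)
From mathcomp Require Import all_boot all_order all_algebra.
From mathcomp Require Import all_classical all_reals all_analysis.
Import Order.TTheory GRing.Theory Num.Theory numFieldNormedType.Exports.

Set Implicit Arguments.
Unset Strict Implicit.
Unset Printing Implicit Defensive.

Local Open Scope classical_set_scope.

Definition squares : set nat := [set (n ^ 2)%N | n in [set: nat]].

Definition hilbert_cube (d : nat) (a0 : nat) (a : 'I_d -> nat) : set nat :=
  [set (a0 + \sum_(k < d) eps k * a k)%N | eps in [set: 'I_d -> bool]].

(* In the quadruple [a], [a ord0] is the base point of the cube and
   [a (lift ord0 k)], for [k : 'I_3], is its side number [k + 1]. *)
Definition Hplus : set ('I_4 -> nat) :=
  [set a | (forall i, (0 < a i)%N) /\
           hilbert_cube (a ord0) (fun k : 'I_3 => a (lift ord0 k))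
             `<=` squares].

Definition Hratio (i j : 'I_4) : set rat :=
  [set ((a i)%:R / (a j)%:R)%R | a in Hplus].

(* [A] is a dense subset of [B] for the subspace topology of [B]; the library's
   [dense] only covers density in the whole space. *)
Definition dense_in (T : topologicalType) (A B : set T) : Prop :=
  A `<=` B /\ B `<=` closure A.

(* Main.v *)
(** Take a_1 = a_2 = n: the cube then consists of two three-term progressions of
    squares with common difference n, and a_3 is the difference of their middle
    terms. A progression with middle term x and difference n corresponds to a
    point of abscissa x on the congruent number curve y^2 = x^3 - n^2 x which is
    a double. In the coordinate w = x / n, doubling reads
    w |-> dbl w = (w^2 + 1)^2 / (4 (w^3 - w)), so that w and dbl w are the ratios
    of two progressions with the same difference, and when dbl w < w the cube
    has a_0 / n = dbl w - 1 and a_3 / n = w - dbl w. Any w = dbl t with t > 1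
    rational occurs, hence w ranges over a dense subset of ]1, +oo[. By
    continuity and the intermediate value theorem both ratios are dense in the
    positive reals; permuting the sides gives all pairs (i, j). *)
Require Import Defs.
From mathcomp Require Import all_boot all_order all_algebra.
From mathcomp Require Import all_classical all_reals all_analysis.
From mathcomp Require Import ring lra zify.
Import Order.TTheory GRing.Theory Num.Theory numFieldNormedType.Exports.

Set Implicit Arguments.
Unset Strict Implicit.
Unset Printing Implicit Defensive.

Local Open Scope classical_set_scope.
Local Open Scope ring_scope.

Lemma closure_image_near (T U : topologicalType) (S : set T) (P : T -> Prop)
    (f : T -> U) (t : T) :
  closure S t -> {for t, continuous f} -> (\forall s \near t, P s) ->
  closure (f @` [set s | S s /\ P s]) (f t).
Proof.
move=> St ft Pt B Bft.
have fB : \forall s \near t, B (f s) by exact: ft.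
have [s [Ss [Bs Ps]]] := St _ (filterI fB Pt).
by exists (f s); split => //; exists s.
Qed.

(** * Cubes with two equal sides *)

Lemma squares_absz (n : nat) (z : int) : n%:Z = z ^+ 2 -> squares n.
Proof. by move=> nz; exists `|z|%N => //; rewrite -abszX -nz. Qed.

(** The slot [k] of the odd side is a parameter, so that one family serves every pair [(i, j)]. *)
Definition two_side_quad (k : 'I_4) (x d e : nat) (l : 'I_4) : nat :=
  if l == ord0 then x else if l == k then e else d.

(** Two equal sides make the eight vertices collapse to six, wherever the third side sits. *)
Lemma two_side_quad_Hplus (k : 'I_4) (x d e : nat) : k != ord0 ->
  (0 < x)%N -> (0 < d)%N -> (0 < e)%N ->
  squares x -> squares (x + d)%N -> squares (x + d + d)%N ->
  squares (x + e)%N -> squares (x + e + d)%N -> squares (x + e + d + d)%N ->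
  Hplus (two_side_quad k x d e).
Proof.
move=> k0 x0 d0 e0 s0 s1 s2 s3 s4 s5; split=> [l|_ [eps _ <-]].
  by rewrite /two_side_quad; case: ifP => // _; case: ifP.
have sq n : n \in [:: x; x + d; x + d + d; x + e; x + e + d; x + e + d + d]%N ->
    squares n.
  by rewrite !inE => /or4P[/eqP->|/eqP->|/eqP->|/or3P[] /eqP->].
rewrite !big_ord_recl big_ord0 /two_side_quad; apply: sq; rewrite !inE.
by move: (eps _) (eps _) (eps _) => [] [] []; case: k k0 => -[|[|[|[|//]]]] //= *; lia.
Qed.

(** For nonzero [b] the 2-adic valuation of the left side would be even and that of the right side
    odd. *)
Lemma sqr_double_eq0 (a b : int) : a ^+ 2 = 2 * b ^+ 2 -> b = 0.
Proof.
move=> /(congr1 absz); rewrite abszM !abszX -[`|2|%N]/2%N => ab.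
apply/eqP; rewrite -absz_eq0; apply/eqP.
case: (posnP `|b|%N) => // b0; have := congr1 (logn 2) ab.
rewrite lognM ?expn_gt0 ?b0// !lognX => /(congr1 odd).
by rewrite oddD !oddM.
Qed.

(** * Progressions of squares and doubling *)

Definition dbl (R : fieldType) (t : R) : R :=
  (t ^+ 2 + 1) ^+ 2 / (4 * (t ^+ 3 - t)).

Lemma dbl_den_gt0 (R : realFieldType) (t : R) : 1 < t -> 0 < 4 * (t ^+ 3 - t).
Proof.
move=> t1; rewrite (_ : t ^+ 3 - t = t * (t - 1) * (t + 1)); last by ring.
by rewrite !mulr_gt0//; lra.
Qed.

Definition ap_ratio (R : fieldType) : set R :=
  [set w | exists A B C m : int, [/\ 0 < m, B ^+ 2 = A ^+ 2 - m,
    C ^+ 2 = A ^+ 2 + m & w = (A ^+ 2)%:~R / m%:~R]].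

(* For t = r / s this is Pythagoras' parametrization: r^2 + s^2 is a hypotenuse,
   and the sum and difference of its legs give [C] and [B]. *)
Lemma dbl_ap_ratio (R : realFieldType) (t : rat) : 1 < t ->
  ap_ratio (dbl (ratr t : R)).
Proof.
move=> t1; set r := numq t; set s := denq t.
have s0 : 0 < s by exact: denq_gt0.
have tE : (ratr t : R) = r%:~R / s%:~R by [].
have sr : s < r.
  by move: t1; rewrite -[t]divq_num_den ltr_pdivlMr ?ltr0z// mul1r ltr_int.
rewrite tE; move: r s s0 sr {tE} => r s s0 sr.
exists (r ^+ 2 + s ^+ 2), (r ^+ 2 - 2 * r * s - s ^+ 2),
  (r ^+ 2 + 2 * r * s - s ^+ 2), (4 * (r * s * (r - s) * (r + s))).
split; [|ring|ring|].
  by rewrite !mulr_gt0// ?subr_gt0// ?addr_gt0//; apply: lt_trans sr.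
have s0R : 0 < s%:~R :> R by rewrite ltr0z.
have srR : s%:~R < r%:~R :> R by rewrite ltr_int.
rewrite /dbl !(rmorphM, rmorphD, rmorphXn, rmorphN)/=.
move: s0R srR; set S : R := s%:~R; set T : R := r%:~R => S0 ST.
have cubic : T ^+ 3 + - T * S ^+ 2 != 0.
  rewrite (_ : _ + _ = T * (T - S) * (T + S)); last by ring.
  by rewrite gt_eqF// !mulr_gt0//; lra.
clearbody S T; field; rewrite cubic !andbT.
by do ?[apply/andP; split]; apply: lt0r_neq0; lra.
Qed.

(** The inequalities provide positivity: [1 < w] gives a positive [d], and [dbl w < w] puts the
    doubled progression below the original one, so that [e] is positive. *)
Lemma ap_ratio_Hplus (R : realFieldType) (w : R) :
  ap_ratio w -> 1 < w -> dbl w < w ->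
  exists x d e : nat,
    [/\ forall k : 'I_4, k != ord0 -> Hplus (two_side_quad k x d e),
        x%:R / d%:R = dbl w - 1 & d%:R / e%:R = (w - dbl w)^-1].
Proof.
move=> [A [B [C [m [m0 hB hC wE]]]]] w1 dw.
have m0R : 0 < m%:~R :> R by rewrite ltr0z.
have XE : (A ^+ 2)%:~R = w * m%:~R by rewrite wE divfK// gt_eqF.
have [X AX] : exists X, A ^+ 2 = X by exists (A ^+ 2).
rewrite AX in XE hB hC.
have mX : m < X by rewrite -(ltr_int R) XE ltr_pMl.
(* The given progression times [(2 * A * B * C) ^+ 2] has difference [d], because
   [X ^+ 2 - m ^+ 2 = (B * C) ^+ 2]. So has the progression of the squares of [Z], [X ^+ 2 + m ^+ 2]
   and [X ^+ 2 + 2 * m * X - m ^+ 2], of ratio [dbl w]; it starts at [x], and [e] is the gap between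
   the two. *)
pose Z := X ^+ 2 - 2 * m * X - m ^+ 2.
pose x := Z ^+ 2; pose d := 4 * m * X * (X ^+ 2 - m ^+ 2).
pose e := 3 * X ^+ 4 - 6 * m ^+ 2 * X ^+ 2 - m ^+ 4.
(* [Z = 0] would mean [(X - m) ^+ 2 = 2 * m ^+ 2]. *)
have Z0 : Z != 0.
  apply/eqP => Z0; have : m = 0; last by move=> m1; rewrite m1 in m0.
  by apply: (@sqr_double_eq0 (X - m)); move: Z0; rewrite /Z; lia.
have x0 : 0 < x by rewrite exprn_even_gt0.
have d0 : 0 < d.
  have X0 : 0 < X by exact: lt_trans mX.
  rewrite /d subr_sqr; apply: mulr_gt0.
    by apply: mulr_gt0 X0; apply: mulr_gt0.
  by apply: mulr_gt0; [rewrite subr_gt0 | exact: addr_gt0].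
have d0R : 0 < d%:~R :> R by rewrite ltr0z.
have dE : d%:~R = 4 * (w ^+ 3 - w) * m%:~R ^+ 4 :> R.
  by rewrite /d !(rmorphM, rmorphD, rmorphXn, rmorphN)/= XE; ring.
have xE : x%:~R = (w ^+ 2 - 2 * w - 1) ^+ 2 * m%:~R ^+ 4 :> R.
  by rewrite /x /Z !(rmorphM, rmorphD, rmorphXn, rmorphN)/= XE; ring.
have eE : e%:~R = (3 * w ^+ 4 - 6 * w ^+ 2 - 1) * m%:~R ^+ 4 :> R.
  by rewrite /e !(rmorphM, rmorphD, rmorphXn, rmorphN)/= XE; ring.
have w3 : 0 < w ^+ 3 - w by have := dbl_den_gt0 w1; rewrite pmulr_rgt0.
have edE : e%:~R = (w - dbl w) * d%:~R.
  by rewrite eE dE /dbl; field; rewrite gt_eqF.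
have e0 : 0 < e by rewrite -(ltr0z R) edE mulr_gt0// subr_gt0.
exists `|x|%N, `|d|%N, `|e|%N; split.
- move=> k k0.
  apply: two_side_quad_Hplus => //; rewrite ?absz_gt0 ?gt_eqF//.
  + apply: (@squares_absz _ Z).
    by rewrite ?PoszD !gtz0_abs// ?exprMn ?AX ?hB ?hC /x /d /e /Z; ring.
  + apply: (@squares_absz _ (X ^+ 2 + m ^+ 2)).
    by rewrite ?PoszD !gtz0_abs// ?exprMn ?AX ?hB ?hC /x /d /e /Z; ring.
  + apply: (@squares_absz _ (X ^+ 2 + 2 * m * X - m ^+ 2)).
    by rewrite ?PoszD !gtz0_abs// ?exprMn ?AX ?hB ?hC /x /d /e /Z; ring.
  + apply: (@squares_absz _ (2 * A * B ^+ 2 * C)).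
    by rewrite ?PoszD !gtz0_abs// ?exprMn ?AX ?hB ?hC /x /d /e /Z; ring.
  + apply: (@squares_absz _ (2 * A ^+ 2 * B * C)).
    by rewrite ?PoszD !gtz0_abs// ?exprMn ?AX ?hB ?hC /x /d /e /Z; ring.
  + apply: (@squares_absz _ (2 * A * B * C ^+ 2)).
    by rewrite ?PoszD !gtz0_abs// ?exprMn ?AX ?hB ?hC /x /d /e /Z; ring.
- rewrite !natr_absz !gtr0_norm// xE dE /dbl; field.
  by rewrite !gt_eqF.
- rewrite !natr_absz !gtr0_norm// edE; field.
  by rewrite !gt_eqF// subr_gt0.
Qed.

(** * Values of [dbl t] and [t - dbl t] for real [t > 1] *)

Lemma continuous_dbl (R : realType) (t : R) :
  1 < t -> {for t, continuous (@dbl R)}.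
Proof.
move=> t1; pose p : {poly R} := ('X ^+ 2 + 1) ^+ 2.
pose q : {poly R} := 4%:P * ('X ^+ 3 - 'X).
have -> : @dbl R = fun u => p.[u] * (q.[u])^-1.
  by apply/funext => u; rewrite /p /q /dbl !hornerE.
apply: continuousM; first exact: continuous_horner.
apply: continuousV; last exact: continuous_horner.
by rewrite /q !hornerE gt_eqF// dbl_den_gt0.
Qed.

Lemma within_continuous_gt (R : realType) (f : R -> R) (c a b : R) :
  (forall t, c < t -> {for t, continuous f}) -> c < a ->
  {within `[a, b], continuous f}.
Proof.
move=> cf ca; apply: continuous_in_subspaceT => t.
rewrite inE/= in_itv/= => /andP[ta _].
by apply: cf; exact: lt_le_trans ta.
Qed.

Lemma dbl_surj (R : realType) (v : R) : 1 < v ->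
  exists2 t : R, 2 <= t & dbl t = v.
Proof.
move=> v1; set s : R := Num.sqrt 2.
have s2 : s ^+ 2 = 2 by rewrite sqr_sqrtr.
have s1 : 1 < s by rewrite -[X in X < _]sqrtr1 ltr_sqrt//; lra.
(* For [t > 1], [dbl t] is at least [t / 4], so [dbl] exceeds [v] at [4 * v + 4]. *)
have ab : 1 + s <= 4 * v + 4 by nra.
have b1 : 1 < 4 * v + 4 by lra.
(* [1 + sqrt 2] is the minimizer of [dbl] on [t > 1]. *)
have [||t] := @IVT _ (@dbl R) (1 + s) (4 * v + 4) v ab.
- by apply: (within_continuous_gt (@continuous_dbl R)); lra.
- have fa : dbl (1 + s) = 1.
    have dn : 0 < 4 * ((1 + s) ^+ 3 - (1 + s)) by apply: dbl_den_gt0; lra.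
    apply: (mulIf (lt0r_neq0 dn)); rewrite /dbl divfK ?gt_eqF// mul1r.
    by rewrite !exprS; nra.
  have fb : v <= dbl (4 * v + 4).
    rewrite /dbl ler_pdivlMr ?dbl_den_gt0//.
    rewrite -subr_ge0; set b := 4 * v + 4 in b1 *.
    have -> : (b ^+ 2 + 1) ^+ 2 - v * (4 * (b ^+ 3 - b)) =
        4 * b * ((b - 1) * (b + 1)) + 3 * b ^+ 2 + 1 by rewrite /b; ring.
    have ? : 0 <= b * ((b - 1) * (b + 1)) by rewrite !mulr_ge0//; lra.
    by have := sqr_ge0 b; lra.
  by rewrite ge_min le_max fa fb (ltW v1) orbT.
by rewrite in_itv/= => /andP[ta _] <-; exists t => //; lra.
Qed.

(** For [t > 1] the difference [t - dbl t] has the sign of [3 * t ^+ 4 - 6 * t ^+ 2 - 1], whose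
    largest root is about 1.47. *)
Lemma dbl_lt (R : realFieldType) (t : R) : 2 <= t -> dbl t < t.
Proof.
move=> t2; rewrite /dbl ltr_pdivrMr ?dbl_den_gt0//; last by lra.
rewrite -subr_gt0.
have -> : t * (4 * (t ^+ 3 - t)) - (t ^+ 2 + 1) ^+ 2 =
    3 * (t ^+ 2 * ((t - 2) * (t + 2))) + 6 * t ^+ 2 - 1 by ring.
have ? : 0 <= t ^+ 2 * ((t - 2) * (t + 2)) by rewrite !mulr_ge0 ?sqr_ge0//; lra.
have ? : 2 ^+ 2 <= t ^+ 2 by rewrite ler_pXn2r// ?nnegrE; lra.
by lra.
Qed.

Lemma subr_dbl_surj (R : realType) (z : R) : 0 < z ->
  exists2 t : R, 1 < t & t - dbl t = z.
Proof.
(* [7 / 5] lies just below the zero of [t - dbl t]; this difference grows like [3 * t / 4], so slope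
   1/2 leaves room at [b]. *)
move=> z0; pose b := 2 * z + 4.
have ab : 7 / 5 <= b by rewrite /b; lra.
have [||t] := @IVT _ (fun t => t - dbl t) (7 / 5) b z ab.
- apply: (@within_continuous_gt _ _ 1); last by lra.
  by move=> t t1; apply: continuousB; [exact: cvg_id | exact: continuous_dbl].
- have fa : 7 / 5 - dbl (7 / 5 : R) <= z.
    have ? : 7 / 5 <= dbl (7 / 5 : R).
      by rewrite /dbl ler_pdivlMr ?dbl_den_gt0//; lra.
    by lra.
  have fb : z <= b - dbl b.
    rewrite lerBrDl -lerBrDr /dbl ler_pdivrMr ?dbl_den_gt0//; last by rewrite /b; lra.
    rewrite -subr_ge0.
    have -> : (b - z) * (4 * (b ^+ 3 - b)) - (b ^+ 2 + 1) ^+ 2 =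
      b ^+ 2 * ((b - 2) * (b + 2)) + 8 * (b * ((b - 1) * (b + 1))) - 1.
      by rewrite /b; field.
    have b4 : 4 <= b by rewrite /b; lra.
    have ? : 1 <= b * ((b - 1) * (b + 1)) by rewrite !mulr_ege1//; lra.
    have ? : 0 <= b ^+ 2 * ((b - 2) * (b + 2)) by rewrite !mulr_ge0 ?sqr_ge0//; lra.
    by lra.
  by rewrite ge_min le_max fa fb orbT.
by rewrite in_itv/= => /andP[ta _] <-; exists t => //; lra.
Qed.

(** * Density *)

Lemma closure_ap_ratio (R : realType) (v : R) : 1 < v -> closure (@ap_ratio R) v.
Proof.
move=> v1; have [t t2 <-] := dbl_surj v1.
have t1 : 1 < t by lra.
have tQ : closure (range (@ratr R)) t.
  move=> B; rewrite nbhsE => -[U [oU Ut] UB].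
  have [q [Uq Qq]] := @dense_rat R U (ex_intro _ t Ut) oU.
  by exists q; split => //; exact: UB.
apply: closure_subset (closure_image_near tQ (continuous_dbl t1) (lt_nbhsr t1)).
by move=> _ [_ [[q _ <-] q1] <-]; apply: dbl_ap_ratio; rewrite -(ltr_rat R) rmorph1.
Qed.

Theorem corollary1p8 (R : realType) (i j : 'I_4) (hij : (i < j)%N) :
  dense_in [set (ratr q : R) | q in Hratio i j] [set x : R | 0 < x].
Proof.
split=> [_ [_ [a [a0 _] <-] <-]|x /= x0].
  by rewrite /= ltr0q divr_gt0// ltr0n.
have quad_ratio k (y d e : nat) : Hplus (two_side_quad k y d e) ->
    [set (ratr q : R) | q in Hratio i j]
      ((two_side_quad k y d e i)%:R / (two_side_quad k y d e j)%:R).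
  move=> H; exists ((two_side_quad k y d e i)%:R / (two_side_quad k y d e j)%:R).
    by exists (two_side_quad k y d e).
  by rewrite fmorph_div/= !ratr_nat.
have j0 : j != ord0 by apply: contraTneq hij => ->.
(* [1 < u] and [dbl u < u] are open conditions, so a continuous [F] carries the density of
   [ap_ratio] near [w] to the ratios. *)
have step (w : R) (F : R -> R) : 1 < w -> dbl w < w -> {for w, continuous F} ->
    (forall u, ap_ratio u -> 1 < u -> dbl u < u ->
      [set (ratr q : R) | q in Hratio i j] (F u)) ->
    closure [set (ratr q : R) | q in Hratio i j] (F w).
  move=> w1 dw cF HF.
  have dw_near : \forall u \near w, 0 < u - dbl u.
    have cw : (fun u => u - dbl u) @ w --> w - dbl w.
      by apply: cvgB; [exact: cvg_id | exact: continuous_dbl].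
    by apply: (cvgr_gt _ cw); rewrite subr_gt0.
  have P : \forall u \near w, 1 < u /\ dbl u < u.
    by near=> u; split; [near: u; exact: lt_nbhsr | rewrite -subr_gt0; near: u].
  apply: closure_subset (closure_image_near (closure_ap_ratio w1) cF P).
  by move=> _ [u [Wu [u1 du]] <-]; exact: HF.
have [i0|i0] := eqVneq i ord0.
- have x1 : 1 < x + 1 by rewrite ltrDr.
  have [w w2 wx] := dbl_surj x1.
  have w1 : 1 < w by lra.
  rewrite (_ : x = dbl w - 1); last by rewrite wx addrK.
  apply: (step w (fun u => dbl u - 1)) => //; first exact: dbl_lt.
    by apply: continuousB; [exact: continuous_dbl | exact: cvg_cst].
  move=> u Wu u1 du; have [y [d [e [H <- _]]]] := ap_ratio_Hplus Wu u1 du.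
  (* With the odd side away from [j], side [j] is one of the two equal sides [d]. *)
  have [k k0 kj] : exists2 k : 'I_4, k != ord0 & j != k.
    by have [->|j1] := eqVneq j (inord 1); [exists (inord 2)|exists (inord 1)];
      rewrite // -val_eqE/= ?inordK.
  have := quad_ratio _ _ _ _ (H k k0).
  by rewrite /two_side_quad i0 eqxx (negPf j0) (negPf kj).
- have xV0 : 0 < x^-1 by rewrite invr_gt0.
  have [w w1 wx] := subr_dbl_surj xV0.
  have dw : dbl w < w by rewrite -subr_gt0 wx invr_gt0.
  rewrite (_ : x = (w - dbl w)^-1); last by rewrite wx invrK.
  apply: (step w (fun u => (u - dbl u)^-1)) => //.
    apply: continuousV; first by rewrite subr_eq0 gt_eqF.
    by apply: continuousB; [exact: cvg_id | exact: continuous_dbl].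
  move=> u Wu u1 du; have [y [d [e [H _ <-]]]] := ap_ratio_Hplus Wu u1 du.
  (* The odd side [e] goes to slot [j], which leaves [d] in slot [i]. *)
  have := quad_ratio _ _ _ _ (H j j0).
  rewrite /two_side_quad (negPf i0) (negPf j0) eqxx.
  by rewrite (negPf (_ : i != j)) // neq_ltn hij.
Unshelve. all: by end_near.
Qed.
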